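(* The computational complexity $\mathrm{comp}(\mathrm{id}_{\overline{\mathbf{C}_n[x]}})$ of the identification problem $\mathrm{id}_{\overline{\mathbf{C}_n[x]}}\colon \overline{\mathbf{C}_n[x]}\to\overline{\mathbf{C}_n[x]}$ for the class $|\Lambda^{\mathrm{std}}|$ is polynomial in $n$. Furthermore, this problem has a solution $(N,\phi)$, with $N$ using information operations from $|\Lambda^{\mathrm{std}}|$, such that $N$ is nonadaptive, $\mathrm{cost}_i(N,v)=(2n+1)^2$ for all $v\in\overline{\mathbf{C}_n[x]}$, and $\sup\{\mathrm{cost}_a(\phi,y)\colon y\in N(\overline{\mathbf{C}_n[x]})\}$ is polynomial in $n$.
   Context: Polynomials: for $n\in\mathbb{N}$, $\mathbf{C}_n[x]$ is the space of complex polynomials $a_0+a_1x+\cdots+a_nx^n$ of degree at most $n$, regarded as functions on $\mathbf{C}$. Write $f\equiv g$ iff $f=ug$ for some $u\in\mathbf{C}$ with $|u|=1$, and $\overline{\mathbf{C}_n[x]}=\mathbf{C}_n[x]/\equiv$. The class $|\Lambda^{\mathrm{std}}|$ consists of all maps $f\mapsto|f(s)|$ with $s\in\mathbf{C}$; these are well defined on $\overline{\mathbf{C}_n[x]}$. Identification problems: let $V$ be a set, $\mathbf{K}\in\{\mathbf{R},\mathbf{C}\}$, and $\mathbf{K}^*$ the set of finite sequences of elements of $\mathbf{K}$. Let $\Lambda$ be a class of maps $V\to\mathbf{K}$ (elementary information operations). An information operator using $\Lambda$ is a map $N\colon V\to\mathbf{K}^*$ of the form $N(v)=(L_1(v),L_2(v;y_1),\ldots,L_{n(v)}(v;y_1,\ldots,y_{n(v)-1}))$,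 where $L_1\in\Lambda$, $y_1=L_1(v)$, and for $i\ge 2$ we have $L_i(\cdot;\bar y)\in\Lambda$ for all $\bar y\in\mathbf{K}^*$ and $y_i=L_i(v;y_1,\ldots,y_{i-1})$. At each step the decision whether to stop or make another evaluation depends only on the values $y_1,y_2,\ldots$ already obtained. $N$ is nonadaptive if the number and choice of operations are fixed beforehand, independently of the values obtained. A solution of $\mathrm{id}_V\colon V\to V$ is a pair $(N,\phi)$ with $N$ an information operator and $\phi\colon\mathbf{K}^*\to V$ an algorithm (possibly partial) such that $\phi\circ N=\mathrm{id}_V$. Model of computation: all objects are encoded as finite sequences of reals (a complex number by its real and imaginary parts; a complex polynomial as $(\mathrm{Re}(a_0),\mathrm{Im}(a_0),\ldots,\mathrm{Re}(a_n),\mathrm{Im}(a_n))$; an element of a quotient by a representative). Algorithms are those computable by a real Blum–Shub–Smale machine augmented with $\sqrt{\cdot}$ and $\sin(\cdot)$, which are also called arithmetic operations; each (real) arithmetic operation has unit cost. Costs: $\mathrm{cost}_i(N,v)=n(v)$; $\mathrm{cost}_a(\phi,y)$ is the number of arithmetic operations performed by $\phi$ on input $y$; $\mathrm{cost}(N,\phi)=\sup_{v\in V}(\mathrm{cost}_i(N,v)+\mathrm{cost}_a(\phi,N(v)))$; $\mathrm{comp}(\mathrm{id}_V)=\inf\{\mathrm{cost}(N,\phi)\colon (N,\phi)\text{ is a solution of }\mathrm{id}_V\}$. ''Polynomial in $n$'' means bounded above by a polynomial in $n$. *)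

(* Defs.v *)
From HB Require Import structures.
From mathcomp Require Import all_boot all_order all_algebra.
From mathcomp Require Import all_classical all_reals all_analysis.
From mathcomp Require Import complex.

Set Implicit Arguments.
Unset Strict Implicit.
Unset Printing Implicit Defensive.

Import Order.TTheory GRing.Theory Num.Theory.
Local Open Scope classical_set_scope.
Local Open Scope ring_scope.
Local Open Scope quotient_scope.

(** * Information operators *)

Section Information.
Variables (V K : Type).

(* The values obtained by the first m evaluations on v; [query y] is the map
   evaluated next, once the values y have been obtained. *)
Fixpoint transcript (query : seq K -> V -> K) (v : V) (m : nat) : seq K :=
  if m is m'.+1 then
    let y := transcript query v m' in rcons y (query y v)
  else [::].

(* [stop y] is only consulted for nonempty y: the first evaluation is always
   made. *)
Record info_operator (Lambda : set (V -> K)) := InfoOperator {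
  query : seq K -> V -> K;
  stop : seq K -> bool;
  query_in : forall y, Lambda (query y);
  stops : forall v, exists m, stop (transcript query v m.+1)
}.

Variable Lambda : set (V -> K).

Definition info_map (N : info_operator Lambda) (v : V) : seq K :=
  transcript (query N) v (ex_minn (stops N v)).+1.

Definition cost_i (N : info_operator Lambda) (v : V) : nat :=
  size (info_map N v).

Definition nonadaptive (N : info_operator Lambda) : Prop :=
  forall y y' : seq K, size y = size y' ->
    query N y = query N y' /\ stop N y = stop N y'.

End Information.

(** * Real Blum-Shub-Smale machines with square root and sine *)

Section Machine.
Variable R : realType.

Inductive binop := OpAdd | OpSub | OpMul | OpDiv.
Inductive unop := OpSqrt | OpSin.

(* Division by zero and the square root of a negative number are undefined:
   they make the computation fail. *)
Definition eval_binop (o : binop) (x y : R) : option R :=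
  match o with
  | OpAdd => Some (x + y)
  | OpSub => Some (x - y)
  | OpMul => Some (x * y)
  | OpDiv => if y == 0 then None else Some (x / y)
  end.

Definition eval_unop (o : unop) (x : R) : option R :=
  match o with
  | OpSqrt => if 0 <= x then Some (Num.sqrt x) else None
  | OpSin => Some (sin x)
  end.

(* The tape is bi-infinite; instructions address fixed cells, and the shifts
   move the tape by one cell, as in the machines over R^infty of Blum, Cucker,
   Shub and Smale. The first argument of an assignment is its target. *)
Inductive instr :=
| IConst of int & R
| ICopy of int & int
| IBinop of binop & int & int & int
| IUnop of unop & int & int
| IBranch of int & nat & nat  (* to the first label iff the cell is >= 0 *)
| IShiftL
| IShiftR.

(* The program counter indexes the list; leaving the list means reaching the
   output node. Nodes other than branches continue with the next one. *)
Definition machine := seq instr.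

Record state := State { pc : nat; tape : int -> R }.

Definition write (T : int -> R) (p : int) (x : R) : int -> R :=
  fun q => if q == p then x else T q.

Definition exec (i : instr) (s : state) : option state :=
  let T := tape s in
  let next T' := State (pc s).+1 T' in
  match i with
  | IConst p c => Some (next (write T p c))
  | ICopy p q => Some (next (write T p (T q)))
  | IBinop o p q r =>
      omap (fun x => next (write T p x)) (eval_binop o (T q) (T r))
  | IUnop o p q =>
      omap (fun x => next (write T p x)) (eval_unop o (T q))
  | IBranch p a b => Some (State (if 0 <= T p then a else b) T)
  | IShiftL => Some (next (fun q => T (q + 1)))
  | IShiftR => Some (next (fun q => T (q - 1)))
  end.

Definition step (M : machine) (s : state) : option state :=
  if onth M (pc s) is Some i then exec i s else Some s.

(* A finite sequence is presented with its length in cell 0 and its entries in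
   the cells 1, 2, ...; the same convention is used for the output. *)
Definition initial_state (y : seq R) : state :=
  State 0 (fun p => match p with
                    | Posz 0 => (size y)%:R
                    | Posz i.+1 => y`_i
                    | Negz _ => 0
                    end).

Definition config (M : machine) (y : seq R) (t : nat) : option state :=
  iter t (obind (step M)) (Some (initial_state y)).

Definition output_on (T : int -> R) (w : seq R) : Prop :=
  T 0 = (size w)%:R /\ forall i : nat, (i < size w)%N -> T i.+1%:Z = w`_i.

Definition outputs (M : machine) (y w : seq R) : Prop :=
  exists t s, [/\ config M y t = Some s, (size M <= pc s)%N
                & output_on (tape s) w].

Definition is_arithmetic (i : instr) : bool :=
  match i with IBinop _ _ _ _ | IUnop _ _ _ => true | _ => false end.

Definition arithmetic_step (M : machine) (c : option state) : bool :=
  if c is Some s then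
    if onth M (pc s) is Some i then is_arithmetic i else false
  else false.

Definition arith_count (M : machine) (y : seq R) (t : nat) : nat :=
  (\sum_(i < t) arithmetic_step M (config M y i))%N.

(* The number of arithmetic operations performed in the whole computation. *)
Definition cost_a (M : machine) (y : seq R) : \bar R :=
  ereal_sup [set ((arith_count M y t)%:R)%:E | t in [set: nat]].

End Machine.

(** * Solutions of the identification problem and its complexity *)

Section Identification.
Variables (R : realType) (V : Type) (Lambda : set (V -> R)).
(* [encodes w v]: the sequence w is an encoding of v. *)
Variable encodes : seq R -> V -> Prop.

(* The partial map phi : R^* -> V computed by M sends y to v when M outputs on
   y an encoding of v; the condition reads phi (N v) = v. *)
Definition solution (N : info_operator Lambda) (M : machine R) : Prop :=
  forall v, exists2 w, outputs M (info_map N v) w & encodes w v.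

Definition cost (N : info_operator Lambda) (M : machine R) : \bar R :=
  ereal_sup [set (((cost_i N v)%:R)%:E + cost_a M (info_map N v))%E
            | v in [set: V]].

Definition comp_id : \bar R :=
  ereal_inf [set c | exists N M, solution N M /\ c = cost N M].

End Identification.

Definition polynomial_in_n (R : realType) (c : nat -> \bar R) : Prop :=
  exists p : {poly R}, forall n : nat, (c n <= (p.[n%:R])%:E)%E.

(** * Polynomials of degree at most n up to a unimodular factor *)

Section PolyModPhase.
Variables (R : realType) (n : nat).

Definition Cpoly := {poly_(n.+1) R[i]}.

Definition phase_equiv (f g : Cpoly) : bool :=
  `[< exists2 u : R[i], `|u| = 1 & f = u *: g >].

Lemma phase_equiv_refl : reflexive phase_equiv.
Proof. by move=> f; apply/asboolP; exists 1; rewrite ?normr1 ?scale1r. Qed.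

Lemma phase_equiv_sym : symmetric phase_equiv.
Proof.
suff H f g : phase_equiv f g -> phase_equiv g f.
  by move=> f g; apply/idP/idP; exact: H.
move=> /asboolP[u u1 ->]; apply/asboolP; exists u^-1.
  by rewrite normfV u1 invr1.
by rewrite scalerA mulVf ?scale1r// -normr_eq0 u1 oner_eq0.
Qed.

Lemma phase_equiv_trans : transitive phase_equiv.
Proof.
move=> g f h /asboolP[u u1 ->] /asboolP[v v1 ->]; apply/asboolP.
by exists (u * v); rewrite ?normrM ?u1 ?v1 ?mulr1// scalerA.
Qed.

Canonical phase_equiv_rel :=
  EquivRel phase_equiv phase_equiv_refl phase_equiv_sym phase_equiv_trans.

Definition CpolyQ := {eq_quot phase_equiv_rel}.
HB.instance Definition _ := EqQuotient.on CpolyQ.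

Definition abs_eval (s : R[i]) (v : CpolyQ) : R :=
  ComplexField.Normc.normc (val (repr v)).[s].

Lemma abs_eval_pi (s : R[i]) (f : Cpoly) :
  abs_eval s (\pi_CpolyQ f) = ComplexField.Normc.normc (val f).[s].
Proof.
rewrite /abs_eval.
have /eqmodP/asboolP[u u1 ->] : repr (\pi_CpolyQ f) = f %[mod CpolyQ].
  by rewrite reprK.
rewrite /= hornerZ ComplexField.Normc.normcM.
suff -> : ComplexField.Normc.normc u = 1 by rewrite mul1r.
by have [] := u1.
Qed.

Definition abs_std : set (CpolyQ -> R) := [set abs_eval s | s in [set: R[i]]].

Definition poly_code (f : Cpoly) : seq R :=
  flatten [seq [:: complex.Re (val f)`_i; complex.Im (val f)`_i]
          | i <- iota 0 n.+1].

Definition class_code (w : seq R) (v : CpolyQ) : Prop :=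
  exists2 f : Cpoly, v = \pi_CpolyQ f & w = poly_code f.

Lemma class_code_inj (w : seq R) (v v' : CpolyQ) :
  class_code w v -> class_code w v' -> v = v'.
Proof.
move=> [f -> ->] [g -> fg]; congr (\pi_CpolyQ _).
pose code (h : Cpoly) i := [:: complex.Re (val h)`_i; complex.Im (val h)`_i].
have H (s : seq nat) :
    flatten [seq code f i | i <- s] = flatten [seq code g i | i <- s] ->
    {in s, forall i, (val f)`_i = (val g)`_i}.
  elim: s => [|j s IH] //= [re im /IH {}IH] i.
  rewrite inE => /predU1P[->|/IH//].
  by apply/eqP; rewrite eq_complex re im !eqxx.
apply/val_inj/polyP => i; have [i_le|i_gt] := ltnP i n.+1.
  by apply: (H _ fg); rewrite mem_iota.
by rewrite !nth_default// (leq_trans _ i_gt)//; [exact: (valP g)|exact: (valP f)].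
Qed.

End PolyModPhase.

(* Main.v *)
Require Import Defs.
From mathcomp Require Import all_boot all_order all_algebra.
From mathcomp Require Import all_classical all_reals all_analysis.
From mathcomp Require Import complex.
From mathcomp Require Import ring zify.

(** Write f = sum_j a_j z^j. The squared samples |f(z)|^2 = sum_(j,k)
a_j conj(a_k) z^j conj(z)^k depend linearly on the (n+1)^2 moments
a_j conj(a_k). With z = x + iy this is a polynomial of degree at most 2n in
each of x and y, so it is determined by its values on the integer grid
0 <= x, y <= 2n; and since z and conj(z) are independent linear forms in x and
y, it in turn determines the moments ([biform_grid_inj]). Hence the linear map
from moments to the (2n+1)^2 grid values is injective and has a left inverse:
every moment is a fixed linear combination of the squared samples
([interpolation], [moment_interpolation]).

The samples are taken on that grid, whatever the values obtained. The machine
for degree n has the coefficients of the left inverse as built-in constants. If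
a_j != 0, the moments a_k conj(a_j) divided by
|a_j| = sqrt(a_j conj(a_j)) are the coefficients of u f with
u = conj(a_j)/|a_j| unimodular, which is a representative of the class of f.
The machine starts from the zero output and goes through all j, overwriting the
output by this representative whenever |a_j|^2 > 0 ([wp_column]): which of the
nonzero a_j fixes the phase does not matter. The output stays zero only when
f = 0 ([wp_recovery]).

There are no loops at run time: the machine is an unrolled list of instructions
in which a branch only skips forward. So its running time, and with it the
number of arithmetic operations, is at most the length of the list, a
polynomial in n ([wp_machine], [size_recovery]). The correctness of the list is
shown by weakest preconditions: [wp c Q T] says that the fragment c, placed
anywhere in a program, takes the tape T to a tape satisfying Q within as many
steps as it has instructions. *)

Set Implicit Arguments.
Unset Strict Implicit.
Unset Printing Implicit Defensive.
Import Order.TTheory GRing.Theory Num.Theory.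
Local Open Scope classical_set_scope.
Local Open Scope ring_scope.

Local Notation normc := ComplexField.Normc.normc.

(** * Interpolation of Hermitian moments on a grid *)

Lemma poly_eq0_nat (F : numDomainType) (p : {poly F}) (m : nat) :
  (size p <= m)%N -> (forall i, (i < m)%N -> p.[i%:R] = 0) -> p = 0.
Proof.
move=> pm p0; apply: (@roots_geq_poly_eq0 _ _ [seq i%:R | i <- iota 0 m]).
- by apply/allP => x /mapP[j]; rewrite mem_iota => /= jm ->; apply/rootP/p0.
- rewrite map_inj_uniq ?iota_uniq// => i j /eqP; rewrite eqr_nat => /eqP //.
- by rewrite size_map size_iota.
Qed.

Lemma coef_eq0 (F : numDomainType) (m : nat) (c : nat -> F) :
  (forall x, \sum_(j < m) c j * x ^+ j = 0) ->
  forall j, (j < m)%N -> c j = 0.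
Proof.
move=> c0 j jm; have pE : \poly_(i < m) c i = 0.
  apply: (poly_eq0_nat (size_poly _ _)) => i _.
  by rewrite horner_poly c0.
by have := coef0 F j; rewrite -pE coef_poly jm.
Qed.

Section Bivariate.
Variables (F : numFieldType) (n : nat) (h : nat -> nat -> F).

Definition biform (z w : F) : F :=
  \sum_(j < n.+1) \sum_(k < n.+1) h j k * z ^+ j * w ^+ k.

(** Along a line in which z and w move affinely, the form restricts to a
univariate polynomial of degree at most 2n, so 2n+1 zeros make it vanish. *)
Lemma biform_line (a b a' b' : F) :
  (forall l, (l < n.*2.+1)%N -> biform (a + b * l%:R) (a' + b' * l%:R) = 0) ->
  forall x, biform (a + b * x) (a' + b' * x) = 0.
Proof.
pose L (u v : F) : {poly F} := u%:P + v%:P * 'X.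
pose p : {poly F} :=
  \sum_(j < n.+1) \sum_(k < n.+1) (h j k)%:P * L a b ^+ j * L a' b' ^+ k.
have pE x : p.[x] = biform (a + b * x) (a' + b' * x).
  rewrite horner_sum; apply: eq_bigr => j _; rewrite horner_sum.
  by apply: eq_bigr => k _; rewrite !(hornerE, horner_exp).
move=> p0 x; rewrite -pE; suff -> : p = 0 by rewrite horner0.
apply: (@poly_eq0_nat _ _ n.*2.+1) => [|i im]; last by rewrite pE p0.
have sL u v m : (size (L u v ^+ m) <= m.+1)%N.
  apply: leq_trans (size_poly_exp_leq _ _) _; rewrite ltnS.
  suff : (size (L u v) <= 2)%N by case: size => [|[|[|]]]; rewrite ?mul1n.
  rewrite /L addrC; apply: leq_trans (size_polyD _ _) _.
  rewrite geq_max mul_polyC (leq_trans (size_scale_leq _ _)) ?size_polyX//.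
  by rewrite (leq_trans (size_polyC_leq1 _)).
apply: leq_trans (size_sum _ _ _) _; apply/bigmax_leqP => j _.
apply: leq_trans (size_sum _ _ _) _; apply/bigmax_leqP => k _.
rewrite -mulrA mul_polyC; apply: leq_trans (size_scale_leq _ _) _.
apply: leq_trans (size_polyMleq _ _) _.
move: (sL a b j) (sL a' b' k) (ltn_ord j) (ltn_ord k).
move: (nat_of_ord j) (nat_of_ord k) => j' k'.
set sj := size (polyseq (_ ^+ j')); set sk := size (polyseq (_ ^+ k')); lia.
Qed.

(** The grid is filled by lines: first the horizontal lines through grid rows,
then every vertical line. Thus the form vanishes at all (x + iy, x - iy), which
are all pairs (z, w) over F since x and y range over F itself, not over its
real elements; its coefficients are then zero. *)
Lemma biform_grid_inj (i : F) : i ^+ 2 = -1 ->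
  (forall l m, (l < n.*2.+1)%N -> (m < n.*2.+1)%N ->
    biform (l%:R + i * m%:R) (l%:R - i * m%:R) = 0) ->
  forall j k, (j < n.+1)%N -> (k < n.+1)%N -> h j k = 0.
Proof.
move=> i2 h0.
have h1 x m : (m < n.*2.+1)%N -> biform (x + i * m%:R) (x - i * m%:R) = 0.
  move=> mn; rewrite [x + _]addrC [x - _]addrC -[x]mul1r.
  apply: biform_line => l ln; rewrite !mul1r addrC [- _ + _]addrC.
  exact: h0.
have h2 x y : biform (x + i * y) (x - i * y) = 0.
  by rewrite -mulNr; apply: biform_line => m mn; rewrite mulNr h1.
have h3 z w : biform z w = 0.
  have i0 : i != 0 by rewrite -sqrf_eq0 i2 oppr_eq0 oner_eq0.
  rewrite -(h2 ((z + w) / 2%:R) ((z - w) / (2%:R * i))).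
  by congr biform; field; rewrite i0.
move=> j k jn kn.
have h4 w : \sum_(k < n.+1) h j k * w ^+ k = 0.
  apply: (@coef_eq0 _ n.+1 (fun j => \sum_(k < n.+1) h j k * w ^+ k)) => // z.
  rewrite -[RHS](h3 z w); apply: eq_bigr => j' _; rewrite mulr_suml.
  by apply: eq_bigr => k' _; rewrite mulrAC.
exact: (@coef_eq0 _ n.+1 (h j)).
Qed.

End Bivariate.

Section Samples.
Variables (R : realType) (n : nat).

Definition nsamples : nat := ((2 * n + 1) ^ 2)%N.

(** The grid {0..2n} x {0..2n}, enumerated row by row. *)
Definition sample_point (t : nat) : R[i] :=
  ((t %% (2 * n + 1))%:R +i* (t %/ (2 * n + 1))%:R)%C.

(** The evaluation matrix, indexed by pairs of exponents and by sample points,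
is row-free by injectivity on the grid; B is its right inverse. *)
Lemma interpolation :
  exists B : nat -> nat -> nat -> R[i], forall h : nat -> nat -> R[i],
  forall j k, (j < n.+1)%N -> (k < n.+1)%N ->
    h j k = \sum_(t < nsamples)
      biform n h (sample_point t) (conjc (sample_point t)) * B j k t.
Proof.
pose G t : 'M[R[i]]_n.+1 :=
  \matrix_(j, k) (sample_point t ^+ j * conjc (sample_point t) ^+ k).
pose A := \matrix_(p < n.+1 * n.+1, t < nsamples) mxvec (G t) 0 p.
have AE (H : 'M[R[i]]_n.+1) t : (mxvec H *m A) 0 t =
    \sum_(j < n.+1) \sum_(k < n.+1)
      H j k * sample_point t ^+ j * conjc (sample_point t) ^+ k.
  rewrite mxE (reindex _ (curry_mxvec_bij _ _)) /= pair_bigA /=.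
  apply: eq_bigr => -[j k] _ /=.
  by rewrite !mxE !mxvecE mxE mulrA.
have natC m : (m%:R : R[i]) = (m%:R +i* 0)%C.
  by rewrite -(rmorph_nat (real_complex R) m).
have /row_freeP[B AB] : row_free A.
  apply/inj_row_free => v; rewrite -(vec_mxK v); set H := vec_mx v => HA.
  (* [inord] turns the matrix H into a function of natural exponents *)
  suff -> : H = 0 by rewrite linear0.
  apply/matrixP => j k; rewrite [RHS]mxE -[j]inord_val -[k]inord_val.
  move: (ltn_ord j) (ltn_ord k).
  apply: (@biform_grid_inj R[i] n (fun j k => H (inord j) (inord k)) 'i%C).
    exact: sqr_i.
  move=> l m ln mn; have tQ : (m * (2 * n + 1) + l < nsamples)%N.
    rewrite /nsamples; nia.
  have ptE : sample_point (m * (2 * n + 1) + l) = l%:R + 'i%C * m%:R.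
    rewrite /sample_point modnMDl modn_small ?divnMDl ?divn_small; try lia.
    by rewrite !natC; simpc; rewrite addn0.
  have := AE H (Ordinal tQ); rewrite HA mxE -[nat_of_ord _]/(m * _ + l)%N ptE.
  have -> : conjc (l%:R + 'i%C * m%:R : R[i]) = l%:R - 'i%C * m%:R.
    by rewrite !natC; simpc.
  move=> ->; apply: eq_bigr => j' _; apply: eq_bigr => k' _.
  by rewrite !inord_val.
(* a sum with a single term extends [B] to all natural indices t *)
exists (fun j k t => \sum_(t' < nsamples | t' == t :> nat)
  B t' (mxvec_index (inord j) (inord k))).
move=> h j k jn kn.
pose H : 'M[R[i]]_n.+1 := \matrix_(j, k) h j k.
have : h j k = (mxvec H *m A *m B) 0 (mxvec_index (inord j) (inord k)).
  by rewrite -mulmxA AB mulmx1 mxvecE mxE !inordK.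
rewrite mxE => ->; apply: eq_bigr => t _; rewrite (big_pred1 t) ?AE//.
congr (_ * _); apply: eq_bigr => j' _; apply: eq_bigr => k' _.
by rewrite mxE.
Qed.

End Samples.

(** * Program fragments and their weakest preconditions *)

Section Code.
Variable R : realType.
Implicit Types (T : int -> R) (M : machine R).

(** A fragment depends on the position of its first instruction, because the
labels of branches are absolute. *)
Definition fragment := nat -> seq (instr R).

Definition computes (c : fragment) T T' : Prop :=
  forall pre post : seq (instr R), let o := size pre in
  exists2 t, (t <= size (c o))%N &
    iter t (obind (step (pre ++ c o ++ post))) (Some (State o T)) =
    Some (State (o + size (c o)) T').

Definition wp (c : fragment) (Q : (int -> R) -> Prop) T : Prop :=
  exists2 T', computes c T T' & Q T'.

Definition single (i : instr R) : fragment := fun=> [:: i].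

Definition chain (c d : fragment) : fragment :=
  fun o => c o ++ d (o + size (c o))%N.

(** The test is for negativity because a branch takes its first label, here the
one that skips c, on nonnegative values. *)
Definition when_negative (p : int) (c : fragment) : fragment :=
  fun o => IBranch R p (o.+1 + size (c o.+1)) o.+1 :: c o.+1.

Fixpoint loop (m : nat) (F : nat -> fragment) : fragment :=
  if m is m'.+1 then chain (loop m' F) (F m') else fun=> [::].

Lemma wp_mono c (Q Q' : (int -> R) -> Prop) T :
  wp c Q T -> (forall T', Q T' -> Q' T') -> wp c Q' T.
Proof. by move=> [T' cT QT] QQ; exists T' => //; exact: QQ. Qed.

Lemma wp_single i T T' (Q : (int -> R) -> Prop) :
  (forall o, exec i (State o T) = Some (State o.+1 T')) ->
  Q T' -> wp (single i) Q T.
Proof.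
move=> iT QT; exists T' => // pre post /=; exists 1%N => //=.
by rewrite /step onth_cat ltnn subnn /= iT addn1.
Qed.

Lemma wp_const p x (Q : (int -> R) -> Prop) T :
  Q (write T p x) -> wp (single (IConst p x)) Q T.
Proof. exact: wp_single. Qed.

Lemma wp_binop op p q r x (Q : (int -> R) -> Prop) T :
  eval_binop op (T q) (T r) = Some x -> Q (write T p x) ->
  wp (single (IBinop R op p q r)) Q T.
Proof. by move=> opx; apply: wp_single => o /=; rewrite opx. Qed.

Lemma wp_unop op p q x (Q : (int -> R) -> Prop) T :
  eval_unop op (T q) = Some x -> Q (write T p x) ->
  wp (single (IUnop R op p q)) Q T.
Proof. by move=> opx; apply: wp_single => o /=; rewrite opx. Qed.

Lemma wp_chain c d Q T : wp c (wp d Q) T -> wp (chain c d) Q T.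
Proof.
move=> [T1 cT [T2 dT QT]]; exists T2 => // pre post /=.
rewrite /chain; set s := c _.
have [t1 t1s E1] := cT pre (d (size pre + size s)%N ++ post).
have [t2] := dT (pre ++ s) post; rewrite size_cat => t2s E2.
exists (t2 + t1)%N; first by rewrite size_cat addnC leq_add.
rewrite iterD -catA E1 -/s; move: E2; rewrite -catA => ->.
by rewrite size_cat addnA.
Qed.

Lemma wp_when_negative p c (Q : (int -> R) -> Prop) T :
  (T p < 0 -> wp c Q T) -> (0 <= T p -> Q T) -> wp (when_negative p c) Q T.
Proof.
move=> neg nonneg; have [T0|T0] := leP 0 (T p).
  exists T; last exact: nonneg.
  move=> pre post /=; exists 1%N => //=.
  by rewrite /step onth_cat ltnn subnn /= T0 addSnnS.
have [T' cT QT] := neg T0; exists T' => // pre post /=.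
set b := IBranch _ _ _ _; have [t] := cT (rcons pre b) post.
rewrite size_rcons => ts E; exists t.+1 => //.
rewrite iterSr /= /step /= onth_cat ltnn subnn /= leNgt T0 /=.
by move: E; rewrite cat_rcons => ->; rewrite addSnnS.
Qed.

(** The loop is unrolled, so a tape invariant indexed by the number of bodies
executed is enough, and termination is automatic. *)
Lemma wp_loop (I : nat -> (int -> R) -> Prop) m F T :
  I 0%N T -> (forall i T', (i < m)%N -> I i T' -> wp (F i) (I i.+1) T') ->
  wp (loop m F) (I m) T.
Proof.
move=> I0; elim: m => [|m IH] IS /=.
  by exists T => // pre post; exists 0%N => //=; rewrite addn0.
apply: wp_chain; apply: wp_mono (IH _) _ => [i T' im|T']; last exact: IS.
by apply: IS; exact: ltnW.
Qed.

Lemma size_loop m F k : (forall i o, size (F i o) = k) ->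
  forall o, size (loop m F o) = (m * k)%N.
Proof.
move=> Fk; elim: m => //= m IH o.
by rewrite /chain size_cat IH Fk mulSn addnC.
Qed.

Lemma size_chain c d k l : (forall o, size (c o) = k) ->
  (forall o, size (d o) = l) -> forall o, size (chain c d o) = (k + l)%N.
Proof. by move=> ck dl o; rewrite size_cat ck dl. Qed.

Lemma size_when_negative p c k : (forall o, size (c o) = k) ->
  forall o, size (when_negative p c o) = (1 + k)%N.
Proof. by move=> ck o; rewrite /= ck. Qed.

(** A halted configuration is repeated forever without arithmetic, so only the
t steps before it can contribute. *)
Lemma cost_a_le M y t s : config M y t = Some s -> (size M <= pc s)%N ->
  (cost_a M y <= (t%:R)%:E)%E.
Proof.
move=> Ms halt; apply: ge_ereal_sup => _ [u _ <-]; rewrite lee_fin ler_nat.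
have stay v : (t <= v)%N -> config M y v = Some s.
  move=> /subnK <-; elim: (v - t)%N => // w IH; rewrite addSn.
  by rewrite /config iterS -/(config _ _ _) IH /= /step onth_default.
have le v : (v <= t)%N -> (arith_count M y v <= t)%N.
  move=> vt; apply: leq_trans vt; rewrite /arith_count.
  by rewrite -[leqRHS]card_ord -sum1_card leq_sum// => i _; exact: leq_b1.
have [|/ltnW tu] := leqP u t; first exact: le.
rewrite /arith_count -(big_mkord xpredT
  (fun i => nat_of_bool (arithmetic_step M (config M y i)))).
rewrite (big_cat_nat (leq0n t) tu)//=.
rewrite [X in (_ + X)%N]big_nat [X in (_ + X)%N]big1 ?addn0.
  by rewrite big_mkord; exact: le.
by move=> i /andP[ti _]; rewrite stay //= onth_default.
Qed.

(** A fragment started at position 0 of a program consisting of nothing else is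
a machine that leaves its instruction list, having used at most as many steps
as the list is long. *)
Lemma wp_machine (c : fragment) (y w : seq R) :
  wp c (fun T => output_on T w) (tape (initial_state y)) ->
  outputs (c 0%N) y w /\ (cost_a (c 0%N) y <= ((size (c 0%N))%:R)%:E)%E.
Proof.
move=> [T cT wT]; have [t tc] := cT [::] [::]; rewrite /= cats0 add0n => E.
split; first by exists t; exists (State (size (c 0%N)) T).
apply: le_trans (cost_a_le E _) _ => //; by rewrite lee_fin ler_nat.
Qed.

Lemma writeE T p x q : write T p x q = if q == p then x else T q.
Proof. by []. Qed.

End Code.

(** * Moments and the encoding of polynomials *)

Section Encoding.
Variable R : realType.

(** The coordinate of z that stands at position i of an encoding, where real
and imaginary parts alternate. *)
Definition re_im (i : nat) (z : R[i]) : R :=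
  if odd i then complex.Im z else complex.Re z.

Lemma re_imMr i (r : R) z : re_im i ((r%:C)%C * z) = r * re_im i z.
Proof. by case: z => a b; rewrite /re_im; case: odd; simpc. Qed.

Lemma re_im_sum i (m : nat) (F : 'I_m -> R[i]) :
  re_im i (\sum_t F t) = \sum_t re_im i (F t).
Proof.
apply: (big_morph (re_im i)) => [[a b] [c d]|]; rewrite /re_im; by case: odd.
Qed.

Lemma sqr_normcE (z : R[i]) : ((normc z ^+ 2)%:C)%C = z * conjc z.
Proof.
case: z => a b /=; rewrite sqr_sqrtr ?addr_ge0 ?sqr_ge0//; simpc.
by rewrite !expr2 [b * a]mulrC addNr.
Qed.

Variable n : nat.

Lemma size_poly_code (f : Cpoly R n) : size (poly_code f) = (2 * n.+1)%N.
Proof.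
rewrite /poly_code -[in RHS](size_iota 0 n.+1).
by elim: (iota 0 n.+1) => //= k s ->; rewrite mulnS.
Qed.

Lemma nth_poly_code (f : Cpoly R n) i : (i < 2 * n.+1)%N ->
  (poly_code f)`_i = re_im i (val f)`_(i./2).
Proof.
rewrite /poly_code; move: (polyseq _) => a.
suff H k l j : (j < 2 * l)%N ->
    (flatten [seq [:: complex.Re a`_x; complex.Im a`_x] | x <- iota k l])`_j =
    re_im j a`_(k + j./2) by exact: (H 0%N).
elim: l k j => [|l IH] k [|[|j]]//=; rewrite ?addn0// => jl.
rewrite IH ?addSnnS; last by lia.
by rewrite /re_im /= negbK.
Qed.

(** As the squared samples are real, real and imaginary parts of the moments
are combinations of them with real coefficients, as the machine needs. *)
Lemma moment_interpolation : exists B : nat -> nat -> nat -> R[i],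
  forall (f : Cpoly R n) i j k, (j < n.+1)%N -> (k < n.+1)%N ->
  \sum_(t < nsamples n)
     normc (val f).[sample_point R n t] ^+ 2 * re_im i (B j k t) =
  re_im i ((val f)`_j * conjc (val f)`_k).
Proof.
have [B coefB] := interpolation R n; exists B => f i j k jn kn.
rewrite (coefB (fun j k => (val f)`_j * conjc (val f)`_k) j k jn kn) re_im_sum.
apply: eq_bigr => t _; rewrite -re_imMr; congr (re_im i (_ * _)).
rewrite sqr_normcE /biform (horner_coef_wide _ (valP f)) rmorph_sum mulr_suml.
apply: eq_bigr => j' _; rewrite mulr_sumr; apply: eq_bigr => k' _.
by rewrite rmorphM rmorphXn mulrACA !mulrA.
Qed.

End Encoding.

(** * Recovery of a representative from its samples *)

Section Recovery.
Variables (R : realType) (n : nat) (B : nat -> nat -> nat -> R[i]).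
Local Notation Q := (nsamples n).

(** The squared samples are kept in the cells -1, ..., -Q, out of the way of
the output; the two cells to the left of them hold intermediate results. *)
Definition scratch : int := Negz Q.
Definition pivot : int := Negz Q.+1.

Definition combination (b : nat -> R) (p : int) : fragment R :=
  chain (single (IConst p 0)) (loop Q (fun t =>
    chain (single (IConst scratch (b t)))
   (chain (single (IBinop R OpMul scratch scratch (Negz t)))
          (single (IBinop R OpAdd p p scratch))))).

(** A nonzero a_j fixes the phase: f times conj(a_j)/|a_j| has the coefficients
a_k conj(a_j)/|a_j|, which are known from the moments. *)
Definition column (j : nat) : fragment R :=
  (* the guard is - |a_j|^2, as the test is for negativity *)
  chain (combination (fun t => - re_im 0 (B j j t)) pivot)
  (when_negative pivot
    (chain (combination (fun t => re_im 0 (B j j t)) pivot)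
    (chain (single (IUnop R OpSqrt pivot pivot))
    (loop (2 * n.+1) (fun i =>
       chain (combination (fun t => re_im i (B i./2 j t)) i.+1)
             (single (IBinop R OpDiv i.+1 i.+1 pivot))))))).

Definition recovery : fragment R :=
  chain (loop Q (fun t => single (IBinop R OpMul (Negz t) t.+1 t.+1)))
 (chain (single (IConst 0 (2 * n.+1)%:R))
 (chain (loop (2 * n.+1) (fun i => single (IConst i.+1%:Z 0)))
        (loop n.+1 column))).

Definition stored (m : nat -> R) (T : int -> R) : Prop :=
  forall t, (t < Q)%N -> T (Negz t) = m t.

Lemma wp_combination m (b : nat -> R) p (P : (int -> R) -> Prop) T :
  stored m T -> (forall t, (t <= Q)%N -> p <> Negz t) ->
  (forall T', T' p = \sum_(t < Q) m t * b t ->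
     (forall q, q <> p -> q <> scratch -> T' q = T q) -> P T') ->
  wp (combination b p) P T.
Proof.
move=> mT pQ HP; apply: wp_chain; apply: wp_const.
pose I k T' := T' p = \sum_(t < k) m t * b t /\
  forall q, q <> p -> q <> scratch -> T' q = T q.
apply: (@wp_mono _ _ (I Q)) => [|T' [Tp Tq]]; last exact: HP.
have pS : (p == scratch) = false by apply/eqP; exact: pQ.
apply: wp_loop => [|t T1 tQ [Tp Tq]].
  split; first by rewrite big_ord0 writeE eqxx.
  by move=> q /eqP/negPf qp _; rewrite writeE qp.
have tS : (Negz t == scratch) = false by apply/eqP => -[]; lia.
apply: wp_chain; apply: wp_const.
apply: wp_chain; apply: wp_binop; first exact: erefl.
apply: wp_binop; first exact: erefl.
split.
  rewrite !writeE !eqxx pS tS Tp big_ord_recr /= mulrC Tq.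
  - by rewrite mT// mulrC.
  - by move/esym; apply: pQ; apply: ltnW.
  - by apply/eqP; rewrite tS.
move=> q qp qs; rewrite !writeE; move/eqP/negPf: (qp) => ->.
by move/eqP/negPf: (qs) => ->; exact: Tq.
Qed.

Section Correctness.
Variables (f : Cpoly R n).
Local Notation m := (fun t => normc (val f).[sample_point R n t] ^+ 2).
Hypothesis coefB : forall i j k, (j < n.+1)%N -> (k < n.+1)%N ->
  \sum_(t < Q) m t * re_im i (B j k t) =
  re_im i ((val f)`_j * conjc (val f)`_k).

Definition recovered (T : int -> R) : Prop := exists2 u : R[i], normc u = 1 &
  forall i, (i < 2 * n.+1)%N -> T i.+1 = re_im i (u * (val f)`_(i./2)).

Definition ready (T : int -> R) : Prop :=
  stored m T /\ T 0 = (2 * n.+1)%:R.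

(** After the columns below j: either some column has written a representative,
and then later ones can only replace it by another one, or a_0, ..., a_(j-1)
all vanish and the output is still zero. *)
Definition column_invariant (j : nat) (T : int -> R) : Prop :=
  ready T /\ (recovered T \/
    (forall k, (k < j)%N -> (val f)`_k = 0) /\
    (forall i, (i < 2 * n.+1)%N -> T i.+1 = 0)).

Lemma ready_frame (T T' : int -> R) : ready T ->
  (forall t, (t < Q)%N -> T' (Negz t) = T (Negz t)) -> T' 0 = T 0 -> ready T'.
Proof. by move=> [sT T0] h h0; split; [move=> t tQ; rewrite h ?sT|rewrite h0]. Qed.

(** A nonnegative guard - |a_j|^2 means a_j = 0, which prolongs the run of
vanishing coefficients; a negative one makes the division legitimate. *)
Lemma wp_column j T : (j < n.+1)%N -> column_invariant j T ->
  wp (column j) (column_invariant j.+1) T.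
Proof.
move=> jn [rT alt].
have pivotQ t : (t <= Q)%N -> pivot <> Negz t by move=> tQ []; lia.
have sqE : re_im 0 ((val f)`_j * conjc (val f)`_j) = normc (val f)`_j ^+ 2.
  by rewrite -sqr_normcE.
have Negz_pivot t : (t < Q)%N -> Negz t <> pivot by move=> tQ []; lia.
have Negz_scratch t : (t < Q)%N -> Negz t <> scratch by move=> tQ []; lia.
apply: wp_chain; apply: (wp_combination (proj1 rT)) => // T1 T1p T1q.
have {T1p} T1p : T1 pivot = - normc (val f)`_j ^+ 2.
  rewrite T1p -sqE -coefB// -sumrN; apply: eq_bigr => t _.
  by rewrite mulrN.
have rT1 : ready T1.
  by apply: (ready_frame rT) => [t tQ|]; rewrite T1q//;
    [exact: Negz_pivot|exact: Negz_scratch].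
apply: wp_when_negative; rewrite T1p; last first.
  rewrite oppr_ge0 => fj; have {}fj : (val f)`_j = 0.
    apply: ComplexField.Normc.eq0_normc; apply/eqP.
    by rewrite -sqrf_eq0 eq_le fj sqr_ge0.
  split=> //; case: alt => [[u u1 Tu]|[f0 T0]].
    by left; exists u => // i im; rewrite T1q//; exact: Tu.
  right; split=> [k|i im]; last by rewrite T1q//; exact: T0.
  by rewrite ltnS leq_eqVlt => /predU1P[->//|]; exact: f0.
rewrite oppr_lt0 => sq_gt0.
have normc_ge0 (z : R[i]) : 0 <= normc z by case: z => a b; exact: sqrtr_ge0.
have nj : normc (val f)`_j != 0.
  by apply: contraTneq sq_gt0 => ->; rewrite expr0n ltxx.
apply: wp_chain; apply: (wp_combination (proj1 rT1)) => // T2 T2p T2q.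
rewrite coefB// sqE in T2p.
apply: wp_chain; apply: (wp_unop (x := normc (val f)`_j)).
  by rewrite /= T2p sqr_ge0 sqrtr_sqr ger0_norm.
set T3 := write _ _ _.
(* the unimodular factor by which this column changes f *)
pose u := ((normc (val f)`_j)^-1%:C)%C * conjc (val f)`_j.
pose J k T' := [/\ ready T', T' pivot = normc (val f)`_j &
  forall i, (i < k)%N -> T' i.+1 = re_im i (u * (val f)`_(i./2))].
apply: (@wp_mono _ _ (J (2 * n.+1)%N)) => [|T' [rT' _ T'u]]; last first.
  split=> //; left; exists u => //.
  rewrite /u ComplexField.Normc.normcM.
  have -> : normc (conjc (val f)`_j) = normc (val f)`_j.
    by case: (_`_j) => a b /=; rewrite sqrrN.
  by rewrite /= expr0n addr0 sqrtr_sqr ger0_norm ?invr_ge0// mulVf.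
have rT3 : ready T3.
  apply: (ready_frame rT1) => [t tQ|]; rewrite /T3 writeE.
    by rewrite (introF eqP (Negz_pivot _ tQ)) T2q//;
      [exact: Negz_pivot|exact: Negz_scratch].
  by rewrite T2q.
apply: wp_loop => [|i T4 im [rT4 T4p T4u]].
  by split; rewrite // /T3 writeE eqxx.
have i2 : (i./2 < n.+1)%N by lia.
apply: wp_chain; apply: (wp_combination (proj1 rT4)) => // T5 T5i T5q.
rewrite coefB// in T5i.
have T5p : T5 pivot = normc (val f)`_j by rewrite T5q// => -[]; lia.
apply: (wp_binop (x := re_im i (u * (val f)`_(i./2)))).
  rewrite /= T5p (negPf nj) T5i; congr Some.
  by rewrite /u -mulrA re_imMr [in RHS]mulrC [conjc _ * _]mulrC.
split=> [||k].
    apply: (ready_frame rT4) => [t tQ|]; rewrite writeE/= T5q//.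
    exact: Negz_scratch.
  by rewrite writeE.
rewrite ltnS writeE leq_eqVlt => /predU1P[->|ki]; first by rewrite eqxx.
rewrite ifF; last by apply/eqP => -[]; lia.
by rewrite T5q ?T4u// => -[]; lia.
Qed.

Lemma wp_recovery y :
  (forall t, (t < Q)%N -> y`_t = normc (val f).[sample_point R n t]) ->
  wp recovery (fun T => T 0 = (2 * n.+1)%:R /\ recovered T)
    (tape (initial_state y)).
Proof.
move=> yf; apply: wp_chain.
pose I k (T : int -> R) := (forall t, (t < k)%N -> T (Negz t) = m t) /\
  forall t, (t < Q)%N -> T t.+1 = y`_t.
apply: (@wp_mono _ _ (I Q)) => [|T1 [sT1 _]].
  apply: wp_loop => [|k T kQ [Tm Ty]]; first by split.
  apply: wp_binop; first exact: erefl.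
  split=> t; rewrite writeE.
    rewrite ltnS leq_eqVlt => /predU1P[->|tk].
      by rewrite eqxx Ty// yf// expr2.
    by rewrite ifF ?Tm//; apply/eqP => -[]; lia.
  by move=> tQ; rewrite /= Ty.
apply: wp_chain; apply: wp_const; apply: wp_chain.
pose J k (T : int -> R) := ready T /\
  forall i, (i < k)%N -> T i.+1 = 0.
apply: (@wp_mono _ _ (J (2 * n.+1)%N)) => [|T2 [rT2 T2z]].
  apply: wp_loop => [|k T kn [rT Tz]]; first by split.
  apply: wp_const; split; first exact: (ready_frame rT).
  move=> i; rewrite ltnS writeE leq_eqVlt => /predU1P[->|ik].
    by rewrite eqxx.
  by rewrite ifF ?Tz//; apply/eqP => -[]; lia.
apply: (@wp_mono _ _ (column_invariant n.+1)) => [|T3 [[_ T30] alt]].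
  apply: wp_loop => [|j T jn]; last exact: wp_column.
  by split=> //; right.
split=> //; case: alt => // -[f0 T3z]; exists 1.
  exact: ComplexField.Normc.normc1.
move=> i im; rewrite T3z// f0; last by lia.
by rewrite mulr0 /re_im; case: odd.
Qed.

End Correctness.

Definition combination_size : nat := (1 + Q * 3)%N.

Definition column_size : nat :=
  (combination_size + (1 + (combination_size +
    (1 + 2 * n.+1 * (combination_size + 1)))))%N.

Definition recovery_size : nat :=
  (Q * 1 + (1 + (2 * n.+1 * 1 + n.+1 * column_size)))%N.

Lemma size_combination b p o : size (combination b p o) = combination_size.
Proof. by apply: size_chain => // o'; exact: size_loop. Qed.

Lemma size_column j o : size (column j o) = column_size.
Proof.
apply: size_chain => [?|]; first exact: size_combination.
apply: size_when_negative; apply: size_chain => [?|].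
  exact: size_combination.
apply: size_chain => //; apply: size_loop => i.
by apply: size_chain => // ?; exact: size_combination.
Qed.

Lemma size_recovery o : size (recovery o) = recovery_size.
Proof.
apply: size_chain => [|o']; first exact: size_loop.
apply: size_chain => // {}o'; apply: size_chain => [|{}o'].
  exact: size_loop.
by apply: size_loop; exact: size_column.
Qed.

End Recovery.

(** * Sampling on the grid *)

Section Information.
Variables (R : realType) (n : nat).

Definition sample (y : seq R) : CpolyQ R n -> R :=
  abs_eval (sample_point R n (size y)).

Lemma transcript_sample v k :
  transcript sample v k = mkseq (fun t => abs_eval (sample_point R n t) v) k.
Proof.
elim: k => //= k ->; rewrite -[in RHS]addn1 /mkseq iotaD map_cat cats1 /=.
by rewrite /sample size_map size_iota.
Qed.

Lemma sample_in y : @abs_std R n (sample y).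
Proof. by exists (sample_point R n (size y)). Qed.

Lemma sample_stops v : exists m,
  (fun y : seq R => nsamples n <= size y)%N (transcript sample v m.+1).
Proof.
by exists (nsamples n); rewrite transcript_sample size_mkseq.
Qed.

Definition sampling : info_operator (@abs_std R n) :=
  InfoOperator sample_in sample_stops.

Lemma nonadaptive_sampling : nonadaptive sampling.
Proof. by move=> y y' yy'; rewrite /= /sample yy'. Qed.

Lemma info_map_sampling v : info_map sampling v =
  mkseq (fun t => abs_eval (sample_point R n t) v) (nsamples n).
Proof.
have stopE k : stop sampling (transcript (query sampling) v k) =
    (nsamples n <= k)%N by rewrite transcript_sample /= size_map size_iota.
rewrite /info_map; case: ex_minnP => m; rewrite stopE => mQ min_m.
rewrite transcript_sample; congr mkseq.
apply/eqP; rewrite eqn_leq mQ andbT.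
have Q0 : (0 < nsamples n)%N by rewrite expn_gt0 addn1.
by rewrite -(prednK Q0) ltnS min_m// stopE prednK.
Qed.

End Information.

(** * The solution and its cost *)

Lemma recovery_solution (R : realType) (n : nat) : exists M : machine R,
  solution (@class_code R n) (sampling R n) M /\
  forall v,
    (cost_a M (info_map (sampling R n) v) <= ((recovery_size n)%:R)%:E)%E.
Proof.
have [B coefB] := moment_interpolation R n.
suff W (v : CpolyQ R n) : exists2 w, class_code w v &
    wp (recovery n B) (fun T => output_on T w)
       (tape (initial_state (info_map (sampling R n) v))).
  exists (recovery n B 0%N); split=> v; have [w vw /wp_machine[out cst]] := W v.
    by exists w.
  by rewrite -(size_recovery n B 0).
pose f := repr v.
have fv : \pi_(CpolyQ R n)%qT f = v by rewrite reprK.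
have yf t : (t < nsamples n)%N ->
    (info_map (sampling R n) v)`_t = normc (val f).[sample_point R n t].
  by move=> tQ; rewrite info_map_sampling nth_mkseq// -fv abs_eval_pi.
have [T cT [T0 [u u1 Tu]]] := wp_recovery (coefB f) yf.
exists (poly_code (u *: f)).
  exists (u *: f) => //; rewrite -fv; apply/eqmodP/asboolP.
  exists u^-1; first by rewrite normfV [`|u|]/(normc u)%:C%C u1 invr1.
  rewrite scalerA mulVf ?scale1r//; apply: contra_eq_neq u1 => ->.
  by rewrite ComplexField.Normc.normc0 eq_sym oner_eq0.
exists T => //; split=> [|i]; rewrite size_poly_code// => im.
by rewrite Tu// nth_poly_code//= coefZ.
Qed.

(** [recovery_size] as a polynomial: Q, N and L are the number of samples, the
number of output cells and [combination_size]. *)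
Definition recovery_bound (R : realType) : {poly R} :=
  let Q := (2%:P * 'X + 1%:P) ^+ 2 in
  let N := 2%:P * ('X + 1%:P) in
  let L := 1%:P + Q * 3%:P in
  Q + (1%:P + (N + ('X + 1%:P) * (L + (1%:P + (L + (1%:P + N * (L + 1%:P))))))).

Lemma recovery_boundE (R : realType) n :
  (recovery_bound R).[n%:R] = (recovery_size n)%:R.
Proof.
rewrite /recovery_bound !(hornerD, hornerM, hornerX, hornerC, horner_exp).
rewrite /recovery_size /column_size /combination_size /nsamples -!(addn1 n).
by rewrite !(natrD, natrM, natrX) !mulr1.
Qed.

Theorem theorem4p2 (R : realType) :
  polynomial_in_n (fun n : nat => comp_id (@abs_std R n) (@class_code R n)) /\
  exists (N : forall n : nat, info_operator (@abs_std R n))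
         (M : nat -> machine R),
    (forall n : nat,
       [/\ solution (@class_code R n) (N n) (M n),
           nonadaptive (N n)
         & forall v : CpolyQ R n, cost_i (N n) v = ((2 * n + 1) ^ 2)%N]) /\
    polynomial_in_n (fun n : nat =>
      ereal_sup [set cost_a (M n) y | y in range (info_map (N n))]).
Proof.
have cost_iE n (v : CpolyQ R n) : cost_i (sampling R n) v = nsamples n.
  by rewrite /cost_i info_map_sampling size_mkseq.
have [M HM] := choice (recovery_solution R).
split.
  exists ((2%:P * 'X + 1%:P) ^+ 2 + recovery_bound R) => n.
  have [sol cost_le] := HM n.
  apply: (@le_trans _ _ (cost (sampling R n) (M n))).
    by apply: ereal_inf_lbound; exists (sampling R n), (M n).
  apply: ge_ereal_sup => _ [v _ <-].
  rewrite hornerD recovery_boundE EFinD cost_iE leeD// lee_fin.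
  rewrite !(hornerD, hornerM, hornerX, hornerC, horner_exp).
  by rewrite /nsamples natrX natrD natrM.
exists (sampling R), M; split=> [n|].
  split; [exact: (proj1 (HM n))|exact: nonadaptive_sampling|exact: cost_iE].
exists (recovery_bound R) => n; apply: ge_ereal_sup => _ [y [v _ <-] <-].
by rewrite recovery_boundE; exact: (proj2 (HM n)).
Qed.
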